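(* Let $r\ge 0$ and $c$ be integers. Let $\mathcal{S}(r,c)$ be the set that contains the first coordinate of all points situated on both the boundary $\partial\mathscr{B}_{\mathrm{pc}}(O,r)$ of $\mathscr{B}_{\mathrm{pc}}(O,r)$ and the line $y=x+c$, i.e. $\mathcal{S}(r,c)=\{x\in\mathbb{Z} : (x,x+c)\in\partial\mathscr{B}_{\mathrm{pc}}(O,r)\}$. Denote the negative part of this set by $\mathcal{S}_{-}(r,c)=\mathcal{S}(r,c)\cap\mathbb{Z}_{<0}$. I. If $r$ and $c$ have opposite parity, or $|c|>r$, then $\mathcal{S}(r,c)=\emptyset$. II. Suppose $r$ and $c$ have the same parity and let $k$ be the integer defined by $|c|=r-2k$. Then $\mathcal{S}(r,c)$ and $\mathcal{S}_{-}(r,c)$ are translations of intervals of integers, which can be explicitly expressed as follows: (a) If $|c|<r$ and $c\equiv r \pmod 2$, then $$\mathcal{S}(r,c)\cap\mathbb{Z}_{\ge 0}=\begin{cases}\left[\binom{r-1-k}{2}+k,\ \binom{r-k}{2}+k\right]\cap\mathbb{Z}, & \text{if } 0\le c\le r-2;\\[6pt] \left[\binom{r-k}{2}+1,\ \binom{r-k+1}{2}\right]\cap\mathbb{Z}, & \text{if } -(r-2)\le c<0.\end{cases}$$ (b) If $-r+2\le c\le 0$, then $$\mathcal{S}_{-}(r,c)=\begin{cases}\big([k-r,-1]\cap\mathbb{Z}\big)+c(k-1)-\binom{k}{2}, & \text{if } k\equiv 1 \pmod 2;\\[6pt] \big([0,r-k-1]\cap\mathbb{Z}\big)+ck-\binom{k+1}{2},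 & \text{if } k\equiv 0 \pmod 2.\end{cases}$$ (c) If $0<c\le r-2$, then $$\mathcal{S}_{-}(r,c)=\begin{cases}\big([0,r-k-1]\cap\mathbb{Z}\big)-c(k+1)-\binom{k+1}{2}, & \text{if } k\equiv 1 \pmod 2;\\[6pt] \big([k-r,-1]\cap\mathbb{Z}\big)-ck-\binom{k}{2}, & \text{if } k\equiv 0 \pmod 2.\end{cases}$$ (d) Lastly, $$\mathcal{S}(r,r)=\left[-r,\binom{r}{2}\right]\cap\mathbb{Z}\quad\text{and}\quad \mathcal{S}(r,-r)=\left[0,\binom{r+1}{2}\right]\cap\mathbb{Z}.$$
   Context: Define the following maps $\mathbb{Z}^2\to\mathbb{Z}^2$: $L'(x,y)=(-x+2y+1,y)$, $L''(x,y)=(x,2x-y+1)$, $M'(x,y)=(x+1,y)$, $M''(x,y)=(x-1,y)$, $M'''(x,y)=(x,y+1)$, $M^{iv}(x,y)=(x,y-1)$. Let $\mathcal{L}=\{L',L''\}$ and $\mathcal{M}=\{M',M'',M''',M^{iv}\}$. The parabolic-taxicab distance between $P,Q\in\mathbb{Z}^2$ is $$d_{\mathrm{pc}}(P,Q)=\min\{n\in\mathbb{Z}_{\ge 0} : \exists\, F_1,\dots,F_n\in\{\mathrm{id}\}\cup\mathcal{L}\cup\mathcal{M},\ F_1\circ\cdots\circ F_n(P)=Q\},$$ where the empty composition ($n=0$) is the identity. For $C\in\mathbb{Z}^2$ and an integer $r\ge 0$, the closed ball is $\mathscr{B}_{\mathrm{pc}}(C,r)=\{X\in\mathbb{Z}^2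 : d_{\mathrm{pc}}(C,X)\le r\}$ and its boundary is $\partial\mathscr{B}_{\mathrm{pc}}(C,r)=\{X\in\mathbb{Z}^2 : d_{\mathrm{pc}}(C,X)=r\}$. Write $O=(0,0)$. For a set $A\subseteq\mathbb{Z}$ and $a\in\mathbb{Z}$, $A+a=\{x+a : x\in A\}$. For integers $n\ge 0$, $\binom{n}{2}=n(n-1)/2$.
   Formalization: The opening claim of II that S(r,c) is a translated interval is false for |c|<r (e.g. S(2,0)={-1,1}); it is stated instead for the nonnegative part of S(r,c), with possibly empty intervals allowed; S(r,r) and S(r,-r) are still given in full by (d). *)

(* Defs.v *)
From mathcomp Require Import all_boot all_order all_algebra.
From mathcomp Require Import all_classical.
Set Implicit Arguments.
Unset Strict Implicit.
Unset Printing Implicit Defensive.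
Import Order.TTheory GRing.Theory Num.Theory.
Local Open Scope classical_set_scope.
Local Open Scope ring_scope.

Definition point : Type := (int * int)%type.

Definition L1 (P : point) : point := (- P.1 + 2 * P.2 + 1, P.2).
Definition L2 (P : point) : point := (P.1, 2 * P.1 - P.2 + 1).
Definition M1 (P : point) : point := (P.1 + 1, P.2).
Definition M2 (P : point) : point := (P.1 - 1, P.2).
Definition M3 (P : point) : point := (P.1, P.2 + 1).
Definition M4 (P : point) : point := (P.1, P.2 - 1).

Definition Lmaps : set (point -> point) := [set F | F = L1 \/ F = L2].
Definition Mmaps : set (point -> point) :=
  [set F | [\/ F = M1, F = M2, F = M3 | F = M4]].
Definition pc_moves : set (point -> point) := [set id] `|` Lmaps `|` Mmaps.

(* [\big[comp/id]_(i < n) F i] is F_0 \o (F_1 \o ... \o F_(n-1)). *)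
Definition pc_reach (P Q : point) (n : nat) : Prop :=
  exists F : 'I_n -> point -> point,
    (forall i, pc_moves (F i)) /\ (\big[comp/id]_(i < n) F i) P = Q.

Lemma pc_reach0 P : pc_reach P P 0.
Proof. by exists (fun=> id); split=> [[]//|]; rewrite big_ord0. Qed.

Lemma pc_reachS P Q n (G : point -> point) :
  pc_moves G -> pc_reach P Q n -> pc_reach P (G Q) n.+1.
Proof.
move=> GM [F [FM FPQ]].
exists (fun i => if unlift ord0 i is Some j then F j else G); split.
  by move=> i; case: (unlift ord0 i) => [j|//]; apply: FM.
rewrite big_ord_recl unlift_none /= -FPQ; congr (G (_ P)).
by apply: eq_bigr => i _; rewrite liftK.
Qed.

Lemma pc_moves_unit (s : bool) :
  pc_moves (fun P => (P.1 + (-1) ^+ s, P.2)) /\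
  pc_moves (fun P => (P.1, P.2 + (-1) ^+ s)).
Proof.
by split; right; case: s;
  [apply: Or42 | apply: Or41 | apply: Or44 | apply: Or43].
Qed.

Lemma pc_reach_ex P Q : exists n, `[< pc_reach P Q n >].
Proof.
have shift (s : bool) (m : nat) (U : point) :
    (exists n, pc_reach P U n) ->
    (exists n, pc_reach P (U.1 + (-1) ^+ s * m%:Z, U.2) n) /\
    (exists n, pc_reach P (U.1, U.2 + (-1) ^+ s * m%:Z) n).
  have [m1 m2] := pc_moves_unit s.
  have e (x : int) (j : nat) :
      x + (-1) ^+ s * j.+1%:Z = x + (-1) ^+ s * j%:Z + (-1) ^+ s.
    by rewrite intS mulrDr mulr1 [(-1) ^+ s + _]addrC addrA.
  case: U => x y /= ex; elim: m => [|m [[a IHa] [b IHb]]].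
    by rewrite mulr0 !addr0.
  rewrite !e; split; first by exists a.+1; apply: pc_reachS m1 IHa.
  by exists b.+1; apply: pc_reachS m2 IHb.
have mv (d : int) : d = (-1) ^+ (d < 0)%R * `|d|%N%:Z by rewrite -intEsign.
have [h _] := shift (Q.1 - P.1 < 0) `|Q.1 - P.1|%N P (ex_intro _ 0%N (pc_reach0 P)).
have [_ [n hn]] := shift (Q.2 - P.2 < 0) `|Q.2 - P.2|%N _ h.
exists n; apply/asboolP; move: hn; rewrite /= -!mv !subrKC.
by case: Q {mv h}.
Qed.

Definition d_pc (P Q : point) : nat := ex_minn (pc_reach_ex P Q).

Definition pc_ball_boundary (C : point) (r : int) : set point :=
  [set X | (d_pc C X)%:Z = r].

Definition S_pc (r c : int) : set int :=
  [set x | pc_ball_boundary (0, 0) r (x, x + c)].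

Definition S_pc_neg (r c : int) : set int := S_pc r c `&` [set x | x < 0].

Definition translate (A : set int) (a : int) : set int := [set x + a | x in A].

(* The interval is allowed to be empty, as happens for [S_pc_neg r (- r)]. *)
Definition translated_interval (A : set int) : Prop :=
  exists a b t : int, A = translate `[a, b]%classic t.

(* The division is exact. *)
Definition binom2 (n : int) : int := (n * (n - 1) %/ 2)%Z.

(* Main.v *)
(* Every move other than [id] changes the parity of [y - x], and changes [|y - x|]
   by at most 1, so the points reachable
   with exactly [n] such moves lie on the lines [y = x + c] with [|c| = n - 2k].
   On each of these lines they form an interval, which grows with [k]; its
   endpoints are found by guessing and verified by induction on [n]: the family of
   intervals is stable under all moves, and each of its points has a predecessor in
   the family for [n - 1]. The sphere of radius [r] on the line is then the interval
   of index [k] minus the one of index [k - 1], and since the latter contains [0]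
   the negative and the nonnegative part of the difference are intervals. *)
Require Import Defs.
From mathcomp Require Import all_boot all_order all_algebra.
From mathcomp Require Import all_classical.
From mathcomp Require Import zify.
Import Order.TTheory GRing.Theory Num.Theory.
Local Open Scope classical_set_scope.
Local Open Scope ring_scope.

(** * Candidate regions and their behaviour under the moves *)

(* Here [a = |y - x|] and [m = min x y], which makes the family symmetric under the
   exchange of the coordinates; both bounds are doubled to avoid binomials. *)
Definition strip (a k m : int) : Prop :=
  - (2 * a * (k + 1)) - k * (k + 1) <= 2 * m <= (a + k) * (a + k - 1) + 2 * k.

Definition region (n : int) (P : Defs.point) : Prop :=
  exists a k m : int, [/\ 0 <= a, 0 <= k, n = a + 2 * k, strip a k m &
    (P.1 = m /\ P.2 = m + a) \/ (P.1 = m + a /\ P.2 = m)].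

Definition swap (P : Defs.point) : Defs.point := (P.2, P.1).

Lemma region_swap n P : region n P -> region n (swap P).
Proof. by move=> [a [k [m [? ? ? ? PE]]]]; exists a, k, m; split=> //=; lia. Qed.

Lemma pc_movesE G : pc_moves G =
  ((G = id \/ (G = L1 \/ G = L2)) \/ [\/ G = M1, G = M2, G = M3 | G = M4]).
Proof. by []. Qed.

(** Conjugation by [swap] exchanges [L1] with [L2], [M1] with [M3] and [M2] with [M4], so that below
    only points on or above the diagonal need a case analysis. *)
Lemma swap_moves G : pc_moves G ->
  exists2 H, pc_moves H & forall P, swap (G P) = H (swap P).
Proof.
rewrite pc_movesE; move=> [[->|[->|->]]|[->|->|->|->]].
- by exists id; rewrite ?pc_movesE //; left; left.
- exists L2; first by rewrite pc_movesE; left; right; right.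
  by move=> P; congr pair => /=; lia.
- exists L1; first by rewrite pc_movesE; left; right; left.
  by move=> P; congr pair => /=; lia.
- by exists M3; rewrite ?pc_movesE //; right; apply: Or43.
- by exists M4; rewrite ?pc_movesE //; right; apply: Or44.
- by exists M1; rewrite ?pc_movesE //; right; apply: Or41.
- by exists M2; rewrite ?pc_movesE //; right; apply: Or42.
Qed.

Lemma region_addn2 n P : region n P -> region (n + 2) P.
Proof.
move=> [a [k [m [a0 k0 -> H PE]]]]; exists a, (k + 1), m.
by rewrite /strip in H *; split=> //; nia.
Qed.

Lemma region_swap_ind (Q : Defs.point -> Prop) n :
  (forall P, Q (swap P) -> Q P) ->
  (forall a k m, 0 <= a -> 0 <= k -> n = a + 2 * k -> strip a k m ->
     Q (m, m + a)) ->
  forall P, region n P -> Q P.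
Proof.
move=> Qswap Qup [x y] [a [k [m [a0 k0 nE H]]]] /= [[-> ->]|[-> ->]].
  exact: (Qup _ _ _ a0 k0 nE H).
by apply: Qswap; exact: (Qup _ _ _ a0 k0 nE H).
Qed.

(** A move that raises [a] by one keeps [k], and a move that lowers [a] by one raises [k] by one;
    either way [a + 2 * k] grows by one. The first alternative accounts for the identity. *)
Lemma region_move n P G :
  pc_moves G -> region n P -> G P = P \/ region (n + 1) (G P).
Proof.
move=> GM RP; move: P RP G GM; apply: region_swap_ind.
  move=> P IH G /swap_moves[H HM GH]; case: (IH H HM); rewrite -GH.
    move=> [? ?]; left; rewrite [LHS]surjective_pairing [RHS]surjective_pairing.
    by congr pair.
  by move=> /region_swap; right; rewrite [G P]surjective_pairing.
move=> a k m a0 k0 -> H G; rewrite pc_movesE.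
(* On the diagonal every move but the identity leads to [a = 1] with the same [k]. *)
have [a1|a1] : 1 <= a \/ a = 0 by lia.
all: move=> [[->|[->|->]]|[->|->|->|->]]; [by left|right..].
all: rewrite /strip in H.
- by exists (a + 1), k, (m + a); rewrite /strip; split=> /=; nia.
- by exists (a - 1), (k + 1), (m - a + 1); rewrite /strip; split=> /=; nia.
- by exists (a - 1), (k + 1), (m + 1); rewrite /strip; split=> /=; nia.
- by exists (a + 1), k, (m - 1); rewrite /strip; split=> /=; nia.
- by exists (a + 1), k, m; rewrite /strip; split=> /=; nia.
- by exists (a - 1), (k + 1), m; rewrite /strip; split=> /=; nia.
- by exists 1, k, m; rewrite /strip; split=> /=; nia.
- by exists 1, k, m; rewrite /strip; split=> /=; nia.
- by exists 1, k, m; rewrite /strip; split=> /=; nia.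
- by exists 1, k, (m - 1); rewrite /strip; split=> /=; nia.
- by exists 1, k, m; rewrite /strip; split=> /=; nia.
- by exists 1, k, (m - 1); rewrite /strip; split=> /=; nia.
Qed.

Lemma region_pred n P : 0 <= n -> region (n + 1) P ->
  exists2 G, pc_moves G & exists2 Q, region n Q & G Q = P.
Proof.
move=> n0; move: P; apply: region_swap_ind.
  move=> P [G /swap_moves[H HM GH] [Q RQ GQ]]; exists H => //; exists (swap Q).
    exact: region_swap.
  by rewrite -GH GQ; case: (P).
move=> a k m a0 k0 nE H; rewrite /strip in H.
have pred G Q : pc_moves G -> G Q = (m, m + a) -> region n Q ->
    exists2 G, pc_moves G & exists2 Q, region n Q & G Q = (m, m + a).
  by move=> GM GQ RQ; exists G => //; exists Q.
have mL1 : pc_moves L1 by rewrite pc_movesE; left; right; left.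
have mL2 : pc_moves L2 by rewrite pc_movesE; left; right; right.
have mM1 : pc_moves M1 by rewrite pc_movesE; right; apply: Or41.
have mM2 : pc_moves M2 by rewrite pc_movesE; right; apply: Or42.
(* For [k > 0] only points near the top of the interval are not in the image of [L1]. *)
have [k1|k1] : 1 <= k \/ k = 0 by lia.
  (* Under [L1] the lower bounds match exactly; the threshold is the upper bound of
     [strip (a + 1) (k - 1)] at [m + a]. *)
  have [hi|hi] : (a + k) * (a + k - 1) - 2 * (a - k + 1) < 2 * m \/
      2 * m <= (a + k) * (a + k - 1) - 2 * (a - k + 1) by lia.
    apply: (pred M1 (m - 1, m + a)) => //; first by congr pair => /=; lia.
    by exists (a + 1), (k - 1), (m - 1); rewrite /strip; split=> /=; nia.
  apply: (pred L1 (m + 2 * a + 1, m + a)) => //; first by congr pair => /=; lia.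
  by exists (a + 1), (k - 1), (m + a); rewrite /strip; split=> /=; nia.
(* For [k = 0], [L2] produces exactly the part [0 <= m] of the interval, and the horizontal step
   [M2] produces the negative part. *)
subst k; have [m0|m0] : 0 <= m \/ m < 0 by lia.
  apply: (pred L2 (m, m - a + 1)) => //; first by congr pair => /=; lia.
  by exists (a - 1), 0, (m - a + 1); rewrite /strip; split=> /=; nia.
(* As [m + 1 <= 0], the upper bound reduces to [0 <= (a - 1) * (a - 2)], true because no integer
   lies strictly between 1 and 2. *)
have a2 : a = 1 \/ 2 <= a by lia.
apply: (pred M2 (m + 1, m + a)) => //; first by congr pair => /=; lia.
by exists (a - 1), 0, (m + 1); rewrite /strip; split=> /=; nia.
Qed.

(** * The distance from the origin in terms of regions *)

Lemma pc_reachSP P Q n : pc_reach P Q n.+1 ->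
  exists2 G, pc_moves G & exists2 U, pc_reach P U n & G U = Q.
Proof.
move=> [F [FM FPQ]]; exists (F ord0); first exact: FM.
exists ((\big[comp/id]_(i < n) F (lift ord0 i)) P); last by rewrite -FPQ big_ord_recl.
by exists (fun i => F (lift ord0 i)); split=> // i; apply: FM.
Qed.

Lemma region0 P : region 0 P <-> P = (0, 0).
Proof.
split=> [|->]; last by exists 0, 0, 0; split=> //=; left.
case: P => x y [a [k [m [a0 k0 nE H]]]] /=; rewrite /strip in H => PE.
by congr pair; nia.
Qed.

Lemma region_reach n P : region n%:Z P -> pc_reach (0, 0) P n.
Proof.
elim: n P => [|n IH] P; first by move/region0->; apply: pc_reach0.
have -> : n.+1%:Z = n%:Z + 1 by lia.
move=> /region_pred[//|G GM [Q RQ <-]].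
by apply: pc_reachS => //; apply: IH.
Qed.

(** The identity lengthens a composition without raising the index, hence an inequality. *)
Lemma reach_region n P : pc_reach (0, 0) P n ->
  exists2 m : nat, (m <= n)%N & region m%:Z P.
Proof.
elim: n P => [|n IH] P.
  by move=> [F []]; rewrite big_ord0 /= => _ <-; exists 0%N => //; apply/region0.
move=> /pc_reachSP[G GM [U /IH[m mn RU] <-]].
have [->|RG] := region_move _ _ _ GM RU; first by exists m => //; apply: leqW.
by exists m.+1 => //; have -> : m.+1%:Z = m%:Z + 1 by lia.
Qed.

Lemma region_parity (n m : int) P :
  region n P -> region m P -> n <= m -> exists j : nat, m = n + 2 * j%:Z.
Proof.
move=> [a [k [u [? ? -> _ PE]]]] [b [l [v [? ? -> _ QE]]]] le.
by exists `|l - k|%N; lia.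
Qed.

Lemma region_addn n P (j : nat) : region n P -> region (n + 2 * j%:Z) P.
Proof.
move=> RP; elim: j => [|j IH]; first by rewrite mulr0 addr0.
have -> : n + 2 * j.+1%:Z = n + 2 * j%:Z + 2 by lia.
exact: region_addn2.
Qed.

(** The indices of the regions containing [P] share the parity of [P.2 - P.1] and are closed under
    adding 2, so the least one is the one that stops being an index when lowered by 2. Regions of
    negative index are empty. *)
Lemma d_pc_region P r :
  (d_pc (0, 0) P)%:Z = r <-> region r P /\ ~ region (r - 2) P.
Proof.
rewrite /d_pc; case: ex_minnP => d /asboolP/reach_region[m md Rm] dmin.
have {md} mE : m = d.
  by apply/eqP; rewrite eqn_leq md dmin //; apply/asboolP/region_reach.
subst m; split=> [<-|[Rr nRr]].
  split=> // Rd; have [m mE] : exists m : nat, d%:Z - 2 = m%:Z.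
    by case: Rd => a [k [u [? ? -> _ _]]]; exists `|(a + 2 * k)%R|%N; lia.
  rewrite mE in Rd; have := dmin m; suff : (m < d)%N; last by lia.
  by rewrite ltnNge => /negP dm dm'; apply/dm/dm'/asboolP/region_reach.
have [m mE] : exists m : nat, r = m%:Z.
  by case: Rr => a [k [u [? ? -> _ _]]]; exists `|(a + 2 * k)%R|%N; lia.
have dr : d%:Z <= r.
  by rewrite mE lez_nat dmin //; apply/asboolP/region_reach; rewrite -mE.
have [[|j] jE] := region_parity _ _ _ Rm Rr dr; first by rewrite jE; lia.
case: nRr; have -> : r - 2 = d%:Z + 2 * j%:Z by lia.
exact: region_addn.
Qed.

(** * Slices of spheres along the lines [y = x + c] *)

(** Half the bounds of [strip] at [a = |c|], turned into bounds on the first coordinate [x] by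
    [min x (x + c) = x + Num.min 0 c]. *)
Definition lo (k c : int) : int := - Num.min 0 c - `|c| * (k + 1) - binom2 (k + 1).
Definition hi (k c : int) : int := - Num.min 0 c + k + binom2 (`|c| + k).

Lemma binom2E (n : int) : 2 * binom2 n = n * (n - 1).
Proof.
rewrite /binom2; have [q [->|->]] : exists q : int, n = 2 * q \/ n = 2 * q + 1.
  by exists (n %/ 2)%Z; lia.
  have -> : 2 * q * (2 * q - 1) = q * (2 * q - 1) * 2 by lia.
  by rewrite mulzK; lia.
have -> : (2 * q + 1) * (2 * q + 1 - 1) = (2 * q + 1) * q * 2 by lia.
by rewrite mulzK; lia.
Qed.

Lemma lohi (k c : int) : 0 <= k -> lo k c <= 0 <= hi k c.
Proof.
move=> k0; have := binom2E (k + 1); have := binom2E (`|c| + k); rewrite /lo /hi.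
have : - `|c| <= Num.min 0 c <= 0 by lia.
have : 0 <= `|c| by lia.
by move: (Num.min 0 c : int) (`|c| : int) => s a; nia.
Qed.

Lemma region_line (n k c x : int) : `|c| = n - 2 * k ->
  region n (x, x + c) <-> 0 <= k /\ lo k c <= x <= hi k c.
Proof.
move=> kE; have stripE : strip `|c| k (x + Num.min 0 c) <-> lo k c <= x <= hi k c.
  have := binom2E (k + 1); have := binom2E (`|c| + k); rewrite /strip /lo /hi.
  by move: (Num.min 0 c : int) (`|c| : int) => s a ? ?; split; lia.
split.
  move=> [a [l [m [a0 l0 nE H]]]] /= PE.
  have [aE [lE mE]] : a = `|c| /\ l = k /\ m = x + Num.min 0 c by lia.
  by subst a l m; split=> //; apply/stripE.
by move=> [k0 /stripE H]; exists `|c|, k, (x + Num.min 0 c); split=> //=; lia.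
Qed.

(** Lowering the radius by 2 lowers [k] by 1. The case [k = 0] stands apart: nothing is removed
    there, although [lo (- 1) c] and [hi (- 1) c] may enclose points. *)
Lemma S_pcE (r k c x : int) : `|c| = r - 2 * k ->
  S_pc r c x <-> [/\ 0 <= k, lo k c <= x <= hi k c &
    k = 0 \/ x < lo (k - 1) c \/ hi (k - 1) c < x].
Proof.
move=> kE; have kE' : `|c| = r - 2 - 2 * (k - 1) by lia.
rewrite /S_pc /pc_ball_boundary /= d_pc_region.
rewrite (region_line _ _ _ _ kE) (region_line _ _ _ _ kE').
by split=> [[[k0 H] nH]|[k0 H nH]]; [split=> //; lia|lia].
Qed.

Lemma S_pc_negE (r k c : int) : `|c| = r - 2 * k -> 0 <= k ->
  S_pc_neg r c = `[lo k c, if k == 0 then -1 else lo (k - 1) c - 1]%classic.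
Proof.
move=> kE k0; have h0 := lohi _ c k0; have h1 := lohi (k - 1) c.
apply/seteqP; split=> x /=; rewrite in_itv /=.
  by move=> [/(S_pcE _ _ _ _ kE)[_ H1 H2] /= H3]; case: eqP => ?; lia.
by case: eqP => ? H; (split; first (apply/(S_pcE _ _ _ _ kE); split)) => /=; lia.
Qed.

Lemma S_pc_nonnegE (r k c : int) : `|c| = r - 2 * k -> 0 <= k ->
  S_pc r c `&` [set x | 0 <= x] =
    `[if k == 0 then 0 else hi (k - 1) c + 1, hi k c]%classic.
Proof.
move=> kE k0; have h0 := lohi _ c k0; have h1 := lohi (k - 1) c.
apply/seteqP; split=> x /=; rewrite in_itv /=.
  by move=> [/(S_pcE _ _ _ _ kE)[_ H1 H2] /= H3]; case: eqP => ?; lia.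
by case: eqP => ? H; (split; first (apply/(S_pcE _ _ _ _ kE); split)) => /=; lia.
Qed.

Lemma S_pc0E (r c : int) : `|c| = r -> S_pc r c = `[lo 0 c, hi 0 c]%classic.
Proof.
move=> cE; have kE : `|c| = r - 2 * 0 by lia.
apply/seteqP; split=> x /=; rewrite in_itv /=; first by case/(S_pcE _ _ _ _ kE).
by move=> H; apply/(S_pcE _ _ _ _ kE); split=> //; left.
Qed.

Lemma S_pc_empty (r c : int) : (r <> c %[mod 2])%Z \/ r < `|c| -> S_pc r c = set0.
Proof.
move=> rc; apply/seteqP; split=> // x; rewrite /S_pc /pc_ball_boundary /=.
by move=> /d_pc_region[[a [k [m [a0 k0 nE _]]]] /=]; lia.
Qed.

Lemma translate_itv (a b t : int) :
  translate `[a, b]%classic t = `[a + t, b + t]%classic.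
Proof.
apply/seteqP; split=> [_ [y /= + <-]|x /=]; rewrite !in_itv /= => H; first by lia.
by exists (x - t); rewrite /= ?in_itv /=; lia.
Qed.

Lemma translated_interval_itv (a b : int) : translated_interval `[a, b]%classic.
Proof. by exists a, b, 0; rewrite translate_itv !addr0. Qed.

Lemma eq_itv (a b a' b' : int) :
  a = a' -> b = b' -> `[a, b]%classic = `[a', b']%classic.
Proof. by move=> -> ->. Qed.

(** Each binomial becomes an unknown tied to its argument by [binom2E]; what remains is linear in
    these unknowns and the monomials. *)
Ltac binom_lia :=
  repeat match goal with
  | |- context [binom2 ?n] => move: (binom2 n) (binom2E n) => ? ?
  end; lia.

Theorem theorem1 (r c : int) (hr : 0 <= r) :
  (* I *)
  ((r <> c %[mod 2])%Z \/ r < `|c| -> S_pc r c = set0) /\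
  (* II *)
  ((r = c %[mod 2])%Z -> forall k : int, `|c| = r - 2 * k ->
    (translated_interval (S_pc r c `&` [set x | 0 <= x]) /\
     translated_interval (S_pc_neg r c)) /\
    (* (a) *)
    (`|c| < r -> (c = r %[mod 2])%Z ->
      (0 <= c <= r - 2 ->
        S_pc r c `&` [set x | 0 <= x] =
          `[binom2 (r - 1 - k) + k, binom2 (r - k) + k]%classic) /\
      (- (r - 2) <= c < 0 ->
        S_pc r c `&` [set x | 0 <= x] =
          `[binom2 (r - k) + 1, binom2 (r - k + 1)]%classic)) /\
    (* (b) *)
    (- r + 2 <= c <= 0 ->
      ((k = 1 %[mod 2])%Z ->
        S_pc_neg r c = translate `[k - r, -1]%classic (c * (k - 1) - binom2 k)) /\
      ((k = 0 %[mod 2])%Z ->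
        S_pc_neg r c = translate `[0, r - k - 1]%classic (c * k - binom2 (k + 1)))) /\
    (* (c) *)
    (0 < c <= r - 2 ->
      ((k = 1 %[mod 2])%Z ->
        S_pc_neg r c =
          translate `[0, r - k - 1]%classic (- c * (k + 1) - binom2 (k + 1))) /\
      ((k = 0 %[mod 2])%Z ->
        S_pc_neg r c = translate `[k - r, -1]%classic (- c * k - binom2 k))) /\
    (* (d) *)
    (S_pc r r = `[- r, binom2 r]%classic /\ S_pc r (- r) = `[0, binom2 (r + 1)]%classic)).
Proof.
split; first exact: S_pc_empty.
move=> rc k kE; split.
  (* A negative [k] means [r < |c|]: both sets are empty, and the empty set is written as an
     interval with reversed ends. *)
  have [k0|k0] : k < 0 \/ 0 <= k by lia.
    rewrite /S_pc_neg S_pc_empty ?set0I; last by right; lia.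
    have -> : set0 = `[1, 0]%classic :> set int.
      by apply/seteqP; split=> x //=; rewrite in_itv /=; lia.
    by split; exact: translated_interval_itv.
  by rewrite (S_pc_nonnegE _ _ _ kE k0) (S_pc_negE _ _ _ kE k0); split;
    exact: translated_interval_itv.
split; [|split; [|split]].
- move=> cr _; have k0 : 0 <= k by lia.
  rewrite (S_pc_nonnegE _ _ _ kE k0); have [|_] := eqVneq k 0; first lia.
  split=> cs.
    have [mE aE] : Num.min 0 c = 0 /\ `|c| = c by lia.
    have -> : r = c + 2 * k by lia.
    by apply: eq_itv; rewrite /hi mE aE; binom_lia.
  have [mE aE] : Num.min 0 c = c /\ `|c| = - c by lia.
  have -> : r = 2 * k - c by lia.
  by apply: eq_itv; rewrite /hi mE aE; binom_lia.
- move=> cs; have k0 : 0 <= k by lia.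
  rewrite (S_pc_negE _ _ _ kE k0); have [|_] := eqVneq k 0; first lia.
  have [mE aE] : Num.min 0 c = c /\ `|c| = - c by lia.
  have -> : r = 2 * k - c by lia.
  (* Both translates have [r - k] points and left end [c * k - binom2 (k + 1)], which is [lo k c]
     for [c <= 0]. *)
  by split=> _; rewrite translate_itv; apply: eq_itv; rewrite /lo mE aE; binom_lia.
- move=> cs; have k0 : 0 <= k by lia.
  rewrite (S_pc_negE _ _ _ kE k0); have [|_] := eqVneq k 0; first lia.
  have [mE aE] : Num.min 0 c = 0 /\ `|c| = c by lia.
  have -> : r = c + 2 * k by lia.
  by split=> _; rewrite translate_itv; apply: eq_itv; rewrite /lo mE aE; binom_lia.
(* On the extreme lines the slice has index 0, so nothing is removed and no splitting by sign is
   required. *)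
- have [mE aE] : Num.min 0 r = 0 /\ `|r| = r by lia.
  have [mE' aE'] : Num.min 0 (- r) = - r /\ `|- r| = r by lia.
  by split; rewrite S_pc0E //; apply: eq_itv; rewrite /lo /hi ?mE ?aE ?mE' ?aE'; binom_lia.
Qed.
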